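(* Let $K$ be a compact space and let $\kappa>\omega$ be a regular cardinal number. Then $K$ is $\kappa$-Corson compact if and only if $C_p(K)\in\mathscr{L}_\kappa$.
   Context: All topological spaces are Tychonoff (completely regular Hausdorff). $C_p(X)$ is the space of real-valued continuous functions on $X$ with the topology of pointwise convergence. For an infinite cardinal $\kappa$ and a set $\Gamma$, $\Sigma_\kappa(\mathbb{R}^\Gamma)=\{x\in\mathbb{R}^\Gamma:|\{\gamma\in\Gamma:x(\gamma)\neq0\}|<\kappa\}$ with the subspace topology from the product $\mathbb{R}^\Gamma$; a compact space is $\kappa$-Corson compact if it is homeomorphic to a subset of $\Sigma_\kappa(\mathbb{R}^\Gamma)$ for some set $\Gamma$. For infinite cardinals $\kappa,\lambda$, $L_\kappa(\lambda)$ is the set $\lambda\cup\{\infty\}$ topologized so that all points $\alpha\in\lambda$ are isolated and the open neighbourhoods of $\infty$ are the sets $\{\infty\}\cup A$ with $A\subseteq\lambda$ and $|\lambda\setminus A|<\kappa$. $\mathscr{L}_\kappa$ is the class of all spaces which are continuous images of closed subsets of the countable product $L_\kappa(\lambda)^\omega$, for some infinite cardinal $\lambda$. *)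

(* Defs.v *)
From HB Require Import structures.
From mathcomp Require Import all_boot all_order all_algebra.
From mathcomp Require Import all_classical all_reals all_analysis.

Set Implicit Arguments.
Unset Strict Implicit.
Unset Printing Implicit Defensive.

Import Order.TTheory GRing.Theory Num.Theory.
Import numFieldNormedType.Exports.

Local Open Scope classical_set_scope.
Local Open Scope card_scope.

Definition card_lt T U (A : set T) (B : set U) : bool :=
  (A #<= B) && ~~ (B #<= A).

Notation "A '#<' B" := (card_lt A B)
  (at level 79, format "A  '#<'  B") : card_scope.

(* There is no type of cardinals: a cardinal is represented by a set of that
   cardinality, and only ever compared through #<= and #<. *)
Record infinite_cardinal := InfiniteCardinal {
  card_carrier :> choiceType;
  card_carrier_infinite : infinite_set [set: card_carrier]
}.

Definition uncountable_cardinal (kappa : infinite_cardinal) : Prop :=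
  [set: nat] #< [set: kappa].

(* Regularity in terms of cardinal sums, {i : I & A i} being the sum of the
   cardinals A i. *)
Definition regular_cardinal (kappa : infinite_cardinal) : Prop :=
  forall (I : Type) (A : I -> Type),
    [set: I] #< [set: kappa] ->
    (forall i, [set: A i] #< [set: kappa]) ->
    [set: {i : I & A i}] #< [set: kappa].

Section card_facts.

Lemma card_leEx T U (A : set T) (B : set U) :
  (exists f : A -> B, injective f) -> A #<= B.
Proof.
move=> [f finj]; apply/card_leP/injfunPex; exists f => //.
by move=> x y _ _; exact: finj.
Qed.

Lemma card_le_graph T U (A : set T) (B : set U) (G : T -> U -> Prop) :
  (forall x, A x -> exists2 y, B y & G x y) ->
  (forall x x' y, A x -> A x' -> G x y -> G x' y -> x = x') -> A #<= B.
Proof.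
move=> Gtot Ginj; apply: card_leEx.
have /choice[f fP] : forall x : A, exists y : B, G (set_val x) (set_val y).
  move=> x; have [y By Gxy] := Gtot _ (set_valP x).
  by exists (SigSub (mem_set By)).
exists f => x y fxy; apply: val_inj.
apply: (Ginj _ _ (set_val (f x))) (fP x) _; try exact: set_valP.
by rewrite fxy; exact: fP.
Qed.

Lemma card_le_total T U (A : set T) (B : set U) : A #<= B \/ B #<= A.
Proof.
pose P (G : set (T * U)) := (forall p, G p -> A p.1 /\ B p.2) /\
  (forall p q, G p -> G q -> (p.1 = q.1 <-> p.2 = q.2)).
have [G [[GAB Ginj] Gmax]] : exists G, P G /\ forall G', G `<` G' -> ~ P G'.
  apply: Zorn_bigcup => F FP Ftot; split=> [p [X FX Xp]|p q [X FX Xp] [Y FY Yq]].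
    exact: (FP _ FX).1.
  have [XY|YX] := Ftot _ _ FX FY.
    exact: (FP _ FY).2 _ _ (XY _ Xp) Yq.
  exact: (FP _ FX).2 _ _ Xp (YX _ Yq).
have [Adom|/existsNP[a /not_implyP[Aa nGa]]] :=
    pselect (forall a, A a -> exists b, G (a, b)).
  left; apply: (@card_le_graph _ _ _ _ (fun x y => G (x, y))).
    by move=> x /Adom[y Gxy]; exists y => //; exact: (GAB _ Gxy).2.
  by move=> x x' y _ _ G1 G2; apply/(Ginj _ _ G1 G2).
have [Bran|/existsNP[b /not_implyP[Bb nGb]]] :=
    pselect (forall b, B b -> exists a, G (a, b)).
  right; apply: (@card_le_graph _ _ _ _ (fun y x => G (x, y))).
    by move=> x /Bran[y Gxy]; exists y => //; exact: (GAB _ Gxy).1.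
  by move=> x x' y _ _ G1 G2; apply/(Ginj _ _ G1 G2).
exfalso; apply: (Gmax (G `|` [set (a, b)])).
  split=> [p Gp|]; first by left.
  by move=> /(_ (a, b) (or_intror erefl)) Gab; apply: nGa; exists b.
split=> [p [/GAB//|->//]|[p1 p2] [q1 q2] [Gp|[-> ->]] [Gq|[-> ->]] //=].
- exact: Ginj Gp Gq.
- by split=> E; exfalso; [apply: nGa; exists p2|apply: nGb; exists p1];
    rewrite -E.
- by split=> E; exfalso; [apply: nGa; exists q2|apply: nGb; exists q1];
    rewrite E.
Qed.

(* Every infinite set B has a subset X, missing only finitely many points of
   B, that is equipotent to two disjoint copies of itself. *)
Lemma infinite_doubling T (B : set T) : infinite_set B ->
  exists X : set T, [/\ X `<=` B, finite_set (B `\` X) &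
    exists h : T -> bool -> T, (forall x b, X x -> X (h x b)) /\
      (forall x b x' b', X x -> X x' -> h x b = h x' b' -> x = x' /\ b = b')].
Proof.
move=> Binf.
pose dom (G : set (T * (bool -> T))) x := exists2 t, G t & t.1 = x.
pose P (G : set (T * (bool -> T))) :=
  (forall t, G t -> B t.1 /\ forall b, dom G (t.2 b)) /\
  (forall s t, G s -> G t -> s.1 = t.1 -> s = t) /\
  (forall s t b c, G s -> G t -> s.2 b = t.2 c -> s = t /\ b = c).
have [G [[GB [Gfun Ginj]] Gmax]] :
    exists G, P G /\ forall G', G `<` G' -> ~ P G'.
  apply: Zorn_bigcup => F FP Ftot.
  have common s t : (\bigcup_(X in F) X) s -> (\bigcup_(X in F) X) t ->
      exists X, [/\ F X, X s & X t].
    move=> [X FX Xs] [Y FY Yt]; have [XY|YX] := Ftot _ _ FX FY.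
      by exists Y; split=> //; exact: XY.
    by exists X; split=> //; exact: YX.
  split; [|split].
  - move=> t [X FX Xt]; have [Bt Xd] := (FP _ FX).1 _ Xt; split=> // b.
    by have [u Xu ub] := Xd b; exists u => //; exists X.
  - move=> s t Us Ut; have [X [FX Xs Xt]] := common _ _ Us Ut.
    exact: (FP _ FX).2.1.
  - move=> s t b c Us Ut; have [X [FX Xs Xt]] := common _ _ Us Ut.
    exact: (FP _ FX).2.2.
exists (dom G); split.
- by move=> _ [t /GB[Bt _] <-].
- apply: contrapT => /infiniteP/card_leP/injfunPex[e0 _ e0inj].
  pose e n : T := set_val (e0 (to_setT n)).
  have einj n m : e n = e m -> n = m.
    move=> /val_inj/(e0inj _ _ (mem_setT _) (mem_setT _)).
    by move=> /(congr1 set_val).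
  have eB n : B (e n) /\ ~ dom G (e n).
    by have [Be nGe] := set_valP (e0 (to_setT n)).
  pose E := [set t | exists n,
    t = (e n, fun b : bool => e ((n * 2) + b)%N)].
  have Gran t b : G t -> dom G (t.2 b) by move=> /GB[_]; exact.
  apply: (Gmax (G `|` E)).
    split=> [p Gp|]; first by left.
    move=> /(_ (e 0%N, _) (or_intror (ex_intro _ 0%N erefl))) G0.
    by apply: (eB 0%N).2; eexists; first exact: G0.
  split; [|split].
  + move=> t [Gt|[n ->]].
      have [Bt dt] := GB _ Gt; split=> // b.
      by have [u Gu ub] := dt b; exists u => //; left.
    split=> [|b]; first exact: (eB n).1.
    eexists; first by right; exists (n * 2 + b)%N.
    by [].
  + move=> s t [Gs|[n ->]] [Gt|[m ->]] //=.
    * exact: Gfun.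
    * by move=> sm; case: (eB m).2; exists s.
    * by move=> tn; case: (eB n).2; exists t.
    * by move=> /einj ->.
  + move=> s t b c [Gs|[n ->]] [Gt|[m ->]] /=.
    * exact: Ginj.
    * by move=> sm; case: (eB (m * 2 + c)%N).2; rewrite -sm; exact: Gran.
    * by move=> tn; case: (eB (n * 2 + b)%N).2; rewrite tn; exact: Gran.
    * move=> /einj nm; have bc : b = c.
        by have := congr1 odd nm; rewrite !oddD !muln2 !odd_double !oddb.
      by move: nm; rewrite bc => /addIn/eqP; rewrite eqn_mul2r /= => /eqP ->.
- have /choice[h hP] : forall x, exists h : bool -> T,
      dom G x -> G (x, h).
    move=> x; have [[[y h] Gt /= <-]|nx] := pselect (dom G x); first by exists h.
    by exists (fun=> x).
  exists h; split=> [x b /hP/GB[_]|x b x' b' /hP Gx /hP Gx']; first exact.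
  by move=> /(Ginj _ _ _ _ Gx Gx')[[]].
Qed.

Lemma card_le_setU T U (A B : set T) (C : set U) : infinite_set C ->
  A #<= C -> B #<= C -> A `|` B #<= C.
Proof.
move=> Cinf AC BC.
have key (V : Type) (D E : set V) (X : set U) (h : U -> bool -> U) :
    (forall x b, X x -> X (h x b)) ->
    (forall x b x' b', X x -> X x' -> h x b = h x' b' -> x = x' /\ b = b') ->
    D #<= X -> E #<= X -> D `|` E #<= X.
  move=> hX hinj /card_leP[f] /card_leP[g].
  pose G (x : V) (y : U) :=
    (exists Dx : x \in D, y = h (set_val (f (SigSub Dx))) true) \/
    (x \notin D /\ exists Ex : x \in E, y = h (set_val (g (SigSub Ex))) false).
  apply: (@card_le_graph _ _ _ _ G).
    move=> x DEx; have [Dx|nDx] := boolP (x \in D).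
      exists (h (set_val (f (SigSub Dx))) true).
        by apply: hX; exact: set_valP.
      by left; exists Dx.
    have Ex : x \in E.
      by apply/mem_set; case: DEx => // /mem_set; rewrite (negbTE nDx).
    exists (h (set_val (g (SigSub Ex))) false).
      by apply: hX; exact: set_valP.
    by right; split=> //; exists Ex.
  move=> x x' y _ _ [[Dx ->]|[nDx [Ex ->]]] [[Dx' E']|[nDx' [Ex' E']]];
    have [|//|+ bb] := hinj _ _ _ _ _ _ E'; try exact: set_valP.
  - by move=> /val_inj/(@inj _ _ _ f _ _ (mem_setT _) (mem_setT _))/(congr1 val).
  - by [].
  - by [].
  - by move=> /val_inj/(@inj _ _ _ g _ _ (mem_setT _) (mem_setT _))/(congr1 val).
have [X [XC Xfin [h [hX hinj]]]] := infinite_doubling Cinf.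
have Xinf : infinite_set X.
  move=> finX; apply: Cinf; rewrite -(setDUK XC) finite_setU; split=> //.
have CX : C #<= X.
  rewrite -(setDUK XC); apply: (key _ _ _ _ h) => //.
  apply: (@card_le_trans _ _ _ [set: nat]); first exact: finite_set_countable.
  exact/infiniteP.
apply: card_le_trans (subset_card_le XC).
by apply: (key _ _ _ _ h) => //; exact: card_le_trans CX.
Qed.

Lemma card_le_lt_trans T U V (A : set T) (B : set U) (C : set V) :
  A #<= B -> B #< C -> A #< C.
Proof.
move=> AB /andP[BC nCB]; apply/andP; split; first exact: card_le_trans BC.
by apply: contra nCB => CA; exact: card_le_trans AB.
Qed.

Lemma finite_card_lt T U (A : set T) (B : set U) :
  finite_set A -> infinite_set B -> A #< B.
Proof.
move=> Afin Binf; apply/andP; split.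
  apply: (@card_le_trans _ _ _ [set: nat]); first exact: finite_set_countable.
  exact/infiniteP.
by apply/negP => /card_le_finite/(_ Afin).
Qed.

Lemma card_lt_setU T U (A B : set T) (C : set U) : infinite_set C ->
  A #< C -> B #< C -> A `|` B #< C.
Proof.
move=> Cinf AC BC.
have aux (D E : set T) : D #<= E -> E #< C -> D `|` E #< C.
  move=> DE EC; have [Efin|Einf] := pselect (finite_set E).
    apply: finite_card_lt => //; rewrite finite_setU; split=> //.
    exact: card_le_finite DE Efin.
  by apply: card_le_lt_trans EC; exact: card_le_setU.
have [AB|BA] := card_le_total A B; first exact: aux.
by rewrite setUC; exact: aux.
Qed.

End card_facts.

(* L_kappa(lambda): the points of lambda are the Some a, and None is the point
   at infinity. *)
Definition Lkappa (kappa lambda : infinite_cardinal) : Type := option lambda.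

Section Lkappa_topology.
Context (kappa lambda : infinite_cardinal).
Local Notation L := (Lkappa kappa lambda).

HB.instance Definition _ := Choice.on L.

Definition Lkappa_open (U : set L) : Prop :=
  U None -> [set a : lambda | ~ U (Some a)] #< [set: kappa].

Let Lkappa_openT : Lkappa_open setT.
Proof.
move=> _; apply: finite_card_lt; last exact: card_carrier_infinite.
by rewrite (_ : mkset _ = set0)// -subset0 => a /(_ I).
Qed.

Let Lkappa_openI : setI_closed Lkappa_open.
Proof.
move=> U V oU oV [/oU cU /oV cV].
rewrite (_ : mkset _ =
  [set a : lambda | ~ U (Some a)] `|` [set a : lambda | ~ V (Some a)]).
  by apply: card_lt_setU => //; exact: card_carrier_infinite.
apply/seteqP; split=> a /=; first by move/not_andP.
by move=> [nU [/nU]|nV [_ /nV]].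
Qed.

Let Lkappa_open_bigU (I : Type) (f : I -> set L) :
  (forall i, Lkappa_open (f i)) -> Lkappa_open (\bigcup_i f i).
Proof.
move=> fo [i _ /fo]; apply: card_le_lt_trans; apply: subset_card_le => a /= nfa.
by move=> fia; apply: nfa; exists i.
Qed.

HB.instance Definition _ := isOpenTopological.Build L
  Lkappa_openT Lkappa_openI Lkappa_open_bigU.

End Lkappa_topology.

Definition tychonoff_space (X : topologicalType) : Prop :=
  hausdorff_space X /\ completely_regular_space X.

(* A set A coerced to a type carries the subspace topology. *)
Definition homeomorphic (X Y : topologicalType) : Prop :=
  exists (f : X -> Y) (g : Y -> X),
    [/\ continuous f, continuous g, cancel f g & cancel g f].

Definition continuous_image (X Y : topologicalType) : Prop :=
  exists f : X -> Y, continuous f /\ range f = [set: Y].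

Definition in_Lkappa_class (kappa : infinite_cardinal) (X : topologicalType) : Prop :=
  tychonoff_space X /\
  exists (lambda : infinite_cardinal)
         (F : set {ptws nat -> Lkappa kappa lambda}),
    closed F /\ continuous_image (set_type F) X.

Definition Sigma_product (R : realType) (kappa : infinite_cardinal)
    (Gamma : Type) : set {ptws Gamma -> R} :=
  [set x | [set gamma | x gamma <> 0%R] #< [set: kappa]].

Definition Corson_compact (R : realType) (kappa : infinite_cardinal)
    (X : topologicalType) : Prop :=
  [/\ tychonoff_space X, compact [set: X] &
    exists (Gamma : Type) (A : set {ptws Gamma -> R}),
      A `<=` @Sigma_product R kappa Gamma /\ homeomorphic X (set_type A)].

Definition Cp (R : realType) (X : topologicalType) : topologicalType :=
  set_type [set f : {ptws X -> R} | continuous (f : X -> R)].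

(* Main.v *)
(* Call a set small if it has fewer than kappa elements.

   If K lies in a Sigma_kappa-product, its coordinate functions, with 0 as the
   value at infinity, form a continuous image of some L_kappa(lambda) in C_p(K).
   By the lattice form of the Stone-Weierstrass theorem every element of C(K) is
   the uniform limit of a fast sequence of functions max_i min_j (a_ij f_ij + b_ij)
   with a_ij, b_ij rational and f_ij coordinates. Such sequences form a closed
   subset of L_kappa(lambda)^omega, since a countable subset of lambda is closed
   and discrete in L_kappa(lambda) when kappa is uncountable.

   Conversely, let C_p(K) be the image of a closed F in L_kappa(lambda)^omega. For
   M in lambda let r_M send the points of lambda outside M to infinity. A closed
   set is preserved by r_M as soon as M is closed under certain finitary
   operations with small values. Doing this for countably many closed sets built
   from F and from the evaluation F x K -> R gives "good" sets M for which the
   restriction of x : F -> R along r_M is again a point of K, so that M induces a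
   retraction rho_M of K. Each x in K has a small support Q with rho_M x
   depending on M /\ Q only. A separating family H with every
   {h in H | h x <> 0} small is obtained by induction along a well-order: the
   good sets generated by initial segments form a continuous chain (M_s), and
   H consists of the functions h o rho_(M_(s+1)) - h o rho_(M_s), with h in the
   family that the induction provides for M_(s+1). *)
From Stdlib Require Inverse_Image.
Require Import Defs.
From mathcomp Require Import all_boot all_order all_algebra.
From mathcomp Require Import all_classical all_reals all_analysis.
From mathcomp Require Import ring lra.
From mathcomp Require wochoice.

Set Implicit Arguments.
Unset Strict Implicit.
Unset Printing Implicit Defensive.

Import Order.TTheory GRing.Theory Num.Theory.
Import numFieldNormedType.Exports.

Local Open Scope classical_set_scope.
Local Open Scope card_scope.

(** * Arithmetic of small sets *)

Section small_sets.
Context (kappa : infinite_cardinal).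
Hypotheses (unc : uncountable_cardinal kappa) (reg : regular_cardinal kappa).

Local Notation small A := (A #< [set: kappa]).

Lemma small_sub T (A B : set T) : A `<=` B -> small B -> small A.
Proof. by move=> /subset_card_le; exact: card_le_lt_trans. Qed.

Lemma small_image T U (f : T -> U) (A : set T) : small A -> small (f @` A).
Proof. exact/card_le_lt_trans/card_image_le. Qed.

Lemma small_countable T (A : set T) : countable A -> small A.
Proof. by move=> cA; exact: card_le_lt_trans unc. Qed.

Lemma small_finite T (A : set T) : finite_set A -> small A.
Proof. by move=> /finite_set_countable; exact: small_countable. Qed.

(** The union injects into the disjoint sum of the [A i], which regularity makes small. *)
Lemma small_bigcup T U (D : set T) (A : T -> set U) :
  small D -> (forall i, D i -> small (A i)) -> small (\bigcup_(i in D) A i).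
Proof.
move=> sD sA.
have := reg (I := set_type D) (A := fun i => set_type (A (set_val i))).
have toT V (X : set V) : small X -> small [set: set_type X].
  by apply: card_le_lt_trans; rewrite (card_le_eql (card_setT X)).
move=> /(_ (toT _ _ sD) (fun i => toT _ _ (sA _ (set_valP i)))).
apply: card_le_lt_trans.
pose G (u : U) (p : {i : set_type D & set_type (A (set_val i))}) :=
  u = set_val (projT2 p).
apply: (@card_le_graph _ _ _ _ G) => [u [i Di Aiu]|u u' p _ _ -> ->//].
by exists (existT _ (SigSub (mem_set Di)) (SigSub (mem_set Aiu))).
Qed.

Lemma small_setU T (A B : set T) : small A -> small B -> small (A `|` B).
Proof. by apply: card_lt_setU; exact: card_carrier_infinite. Qed.

Lemma small_setX T U (A : set T) (B : set U) :
  small A -> small B -> small (A `*` B).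
Proof.
move=> sA sB; have := small_bigcup sA (fun a _ => small_image (pair a) sB).
by apply: small_sub => -[a b] [/= Aa Bb]; exists a => //; exists b.
Qed.

(** Induction settles each fixed length; there are countably many lengths, and [kappa] is
    uncountable. *)
Lemma small_seq (T : eqType) (A : set T) :
  small A -> small [set s : seq T | {in s, forall x, A x}].
Proof.
move=> sA.
have sn n : small [set s : seq T | size s = n /\ {in s, forall x, A x}].
  elim: n => [|n ihn].
    apply: small_finite; apply: sub_finite_set (finite_set1 [::]) => s.
    by move=> [/size0nil ->].
  apply: (small_sub _ (small_bigcup sA (fun a _ => small_image (cons a) ihn))).
  move=> [|a s] [] //= [ss] As; exists a; first by apply: As; rewrite mem_head.
  by exists s => //; split=> // x xs; apply: As; rewrite inE xs orbT.
apply: small_sub (small_bigcup unc (fun n _ => sn n)) => s As.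
by exists (size s).
Qed.

End small_sets.

(** * Convergence and continuity in the pointwise topology *)

Section pointwise_topology.

Lemma ptws_cvg (I : Type) (V : topologicalType) (F : set_system {ptws I -> V})
    (f : {ptws I -> V}) : Filter F ->
  (forall i, (fun g : {ptws I -> V} => g i) @ F --> f i) -> F --> f.
Proof.
move=> FF Ff; apply/cvg_sup => i A [_ [[B oB <-] Bfi] BA].
by apply: filterS BA _; apply: (Ff i); exact: open_nbhs_nbhs.
Qed.

Lemma ptws_eval_continuous (I : Type) (V : topologicalType) (i : I) :
  continuous (fun g : {ptws I -> V} => g i).
Proof.
move=> f A; rewrite nbhsE => -[B [oB Bfi] BA].
have /cvg_sup/(_ i) : nbhs f --> f by exact: cvg_id.
apply; exists ((fun g : {ptws I -> V} => g i) @^-1` B); split=> //.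
  by exists B.
by move=> g /BA.
Qed.

Lemma continuous_ptws (T : topologicalType) (I : Type) (V : topologicalType)
    (h : T -> {ptws I -> V}) :
  (forall i, continuous (fun t => h t i)) -> continuous h.
Proof. by move=> ch t; apply: ptws_cvg => i; exact: ch. Qed.

End pointwise_topology.

Lemma closed_filter_cvg (X : topologicalType) (A : set X) (F : set_system X)
    (x : X) : closed A -> ProperFilter F -> F A -> F --> x -> A x.
Proof.
move=> clA FF FA Fx; apply: clA => B /Fx; rewrite nbhs_simpl => FB.
exact: filter_ex (filterI FA FB).
Qed.

Lemma closed_preimage (X Y : topologicalType) (f : X -> Y) (A : set Y) :
  continuous f -> closed A -> closed (f @^-1` A).
Proof. by move=> /continuous_closedP; exact. Qed.

Section retractions.
Context (T : Type).

Definition retract (M : set T) (o : option T) : option T :=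
  if o is Some a then if `[< M a >] then Some a else None else None.

Lemma retract_Some M o a : retract M o = Some a <-> o = Some a /\ M a.
Proof.
split=> [|[-> /asboolT Ma]]; last by rewrite /retract Ma.
by case: o => //= b; case: asboolP => // Mb [<-].
Qed.

Lemma retract_id M o : (forall a, o = Some a -> M a) -> retract M o = o.
Proof. by case: o => //= a /(_ a erefl)/asboolT ->. Qed.

Lemma retractI M N o : retract M (retract N o) = retract (M `&` N) o.
Proof.
case: o => //= a; rewrite asbool_and.
by case: (asboolP (N a)) => /= _; rewrite ?andbT// andbF.
Qed.

Lemma retractT o : retract setT o = o. Proof. exact: retract_id. Qed.

End retractions.

(** * Closing off under finitary operations with small values *)

Section closing_off.
Context (kappa lambda : infinite_cardinal).
Hypotheses (unc : uncountable_cardinal kappa) (reg : regular_cardinal kappa).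
Context (I J : countType) (C : I -> set {ptws J -> Lkappa kappa lambda}).
Hypothesis clC : forall i, closed (C i).

Local Notation small A := (A #< [set: kappa]).
Local Notation L := (Lkappa kappa lambda).
Implicit Types (M S : set lambda).

(** When no such [B] exists, elements of [C i] with the values [p] can avoid any small set along
    [l], hence come arbitrarily close to being [None] there. *)
Definition bounded_by i (p : seq (J * lambda)) (l : seq J) : set (set lambda) :=
  [set B | small B /\ forall w, C i w -> {in p, forall q, w q.1 = Some q.2} ->
    exists2 j, j \in l & exists2 b, B b & w j = Some b].

(** The default [set0] imposes nothing when there is no small bound. *)
Definition bound i p l : set lambda := xget set0 (bounded_by i p l).

Lemma small_bound i p l : small (bound i p l).
Proof.
rewrite /bound; case: xgetP => [B _ []//|_].
by apply: small_finite; first exact: unc; exact: finite_set0.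
Qed.

Definition good : set (set lambda) :=
  [set M | forall i p l, {in p, forall q, M q.2} -> bound i p l `<=` M].

Lemma good_smallest S : good (smallest good S).
Proof.
move=> i p l pM b bb M [gM SM]; apply: (gM i p l) bb.
by move=> q qp; apply: (pM q qp).
Qed.

(** Each instance of goodness has finitely many parameters [p], and these lie in one member of the
    chain. *)
Lemma good_directed (F : set (set lambda)) : F !=set0 -> F `<=` good ->
  (forall M N, F M -> F N -> M `<=` N \/ N `<=` M) ->
  good (\bigcup_(M in F) M).
Proof.
move=> [M0 FM0] Fg Ftot i p l pM.
suff [M FM {}pM] : exists2 M, F M & {in p, forall q, M q.2}.
  by move=> b /(Fg _ FM _ _ _ pM); exists M.
elim: p pM => [|q p ih] pM; first by exists M0.
have [|M FM Mp] := ih; first by move=> x xp; apply: pM; rewrite inE xp orbT.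
have [N FN Nq] := pM _ (mem_head q p).
have [MN|NM] := Ftot _ _ FM FN; [exists N => //|exists M => //] => x;
  rewrite inE => /orP[/eqP ->|xp] //.
- exact/MN/Mp.
- exact: NM.
- exact: Mp.
Qed.

(* The values of an element of C i on M determine which small sets it must
   meet, and a good M already contains those sets. *)
Lemma good_retract M i (w : {ptws J -> L}) :
  good M -> C i w -> C i (retract M \o w).
Proof.
move=> gM Ciw.
(* Traces on [C i] of basic neighbourhoods of [retract M \o w]: values in [M] are fixed, and the
   small set [jB.2] is avoided at the other coordinates of [jB.1]. *)
pose F := filter_from [set jB : seq J * set lambda | small jB.2]
  (fun jB => [set w' | C i w' /\ forall j, j \in jB.1 ->
    if retract M (w j) is Some a then w' j = Some a
    else forall b, jB.2 b -> w' j <> Some b]).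
have FF : ProperFilter F.
  apply: filter_from_proper; first apply: filter_from_filter.
  - exists ([::], set0) => /=; apply: small_finite unc _ _ _.
    exact: finite_set0.
  - move=> [j1 B1] [j2 B2] /= s1 s2; exists (j1 ++ j2, B1 `|` B2) => /=.
      exact: small_setU.
    move=> w' [Cw' w'P]; split; split=> // j jj.
      have := w'P j; rewrite mem_cat jj => /(_ isT).
      by case: retract => // h b Bb; apply: h; left.
    have := w'P j; rewrite mem_cat jj orbT => /(_ isT).
    by case: retract => // h b Bb; apply: h; right.
  (* If [B] cannot be avoided, [bound i p l] is a genuine bound, so [w] itself meets it at some [j]
     in [l]; but goodness puts it inside [M], while [l] consists of coordinates retracted to
     [None]. *)
  - move=> [js B] /= sB; apply: contrapT => nex.
    pose p := pmap (fun j => omap (pair j) (retract M (w j))) js.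
    pose l := [seq j <- js | retract M (w j) == None].
    have inp q : q \in p -> retract M (w q.1) = Some q.2.
      rewrite mem_pmap => /mapP[j _]; case E: (retract M (w j)) => [a|] //=.
      by move=> [->].
    have [_ /(_ w Ciw)] : bounded_by i p l (bound i p l).
      apply: xgetPex; exists B; split=> // w' Cw' w'p.
      apply: contrapT => nhit; apply: nex; exists w'; split=> // j jjs.
      case E: (retract M (w j)) => [a|].
        apply: (w'p (j, a)); rewrite mem_pmap; apply/mapP.
        by exists j => //; rewrite E.
      move=> b Bb w'j; apply: nhit; exists j; last by exists b.
      by rewrite mem_filter E eqxx.
    case=> [q /inp /retract_Some[] //|j jl [b bb wj]].
    have Mb : M b by apply: gM bb => q /inp /retract_Some[].
    move: jl; rewrite mem_filter => /andP[/eqP]; rewrite wj /=.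
    by move/asboolT: Mb => ->.
have : F --> (retract M \o w : {ptws J -> L}).
  apply: ptws_cvg => j U; rewrite nbhsE => -[V [oV Vj] VU].
  rewrite nbhs_simpl; apply: filterS VU _.
  case E: (retract M (w j)) Vj => [a|] /= Vj; rewrite E in Vj.
    exists ([:: j], set0) => /=; first by apply: small_finite unc _ _ _.
    move=> w' [_ /(_ j)]; rewrite mem_head E => /(_ isT) h.
    by rewrite /preimage/= h.
  exists ([:: j], [set a | ~ V (Some a)]) => /=; first exact: oV.
  move=> w' [_ /(_ j)]; rewrite mem_head E => /(_ isT) h.
  rewrite /preimage/=; case w'j: (w' j) => [b|//]; apply: contrapT => nV.
  exact: h nV w'j.
move=> Fw; apply: (closed_filter_cvg (@clC i) FF _ Fw).
exists ([::], set0) => /=; last by move=> w' [].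
by apply: small_finite unc _ _ _.
Qed.

Let step S := S `|`
  \bigcup_(ipl in [set ipl : I * (seq (J * lambda) * seq J) |
     {in ipl.2.1, forall q, S q.2}]) bound ipl.1 ipl.2.1 ipl.2.2.

Let small_step S : small S -> small (step S).
Proof.
move=> sS; apply: small_setU => //.
apply: small_bigcup => // [|[i [p l]] _]; last exact: small_bound.
have cT (V : countType) (A : set V) : small A by exact: small_countable.
have := small_setX reg (cT I setT) (small_setX reg
   (small_seq unc reg (small_setX reg (cT J setT) sS)) (cT _ [set: seq J])).
apply: small_sub => -[i [p l]] /= pS; split=> //; split=> //= q qp; split=> //.
exact: pS.
Qed.

(** The operations are finitary, so countably many rounds of [step] reach a good set; each round
    adds a small union of small sets because [I] and [J] are countable. *)
Lemma small_smallest S : small S -> small (smallest good S).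
Proof.
move=> sS.
pose U := \bigcup_n iter n step S.
have sU : small U.
  apply: small_bigcup => // n _.
  by elim: n => //= n; exact: small_step.
apply: small_sub sU; apply: smallest_sub; last by move=> a Sa; exists 0%N.
have mono m n : (m <= n)%N -> iter m step S `<=` iter n step S.
  move=> /subnK <-; elim: (n - m)%N => // k ih a /ih ha.
  by rewrite addSn /=; left.
move=> i p l pU.
suff [n pn] : exists n, {in p, forall q, iter n step S q.2}.
  by move=> b bb; exists n.+1 => //=; right; exists (i, (p, l)).
elim: p pU => [|q p ih] pU; first by exists 0%N.
have [|n pn] := ih; first by move=> x xp; apply: pU; rewrite inE xp orbT.
have [m _ qm] := pU _ (mem_head q p).
exists (maxn n m) => x; rewrite inE => /orP[/eqP ->|xp].
  by apply: mono qm; exact: leq_maxr.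
by apply: mono (pn _ xp); exact: leq_maxl.
Qed.

End closing_off.

(** * Compactness, rational cuts and well-orders *)

Local Open Scope ring_scope.

Lemma compact_seq_inter (X : topologicalType) (I : eqType) (D : set I)
    (f : I -> set X) :
  compact [set: X] -> (forall i, D i -> closed (f i)) ->
  (forall s : seq I, {in s, forall i, D i} ->
    exists x, {in s, forall i, f i x}) ->
  exists x, forall i, D i -> f i x.
Proof.
move=> cX fcl fin.
pose G := filter_from [set s : seq I | {in s, forall i, D i}]
  (fun s => [set x | {in s, forall i, f i x}]).
have GG : ProperFilter G.
  apply: filter_from_proper => [|s /fin//]; apply: filter_from_filter.
    by exists [::].
  move=> s t sD tD; exists (s ++ t) => /= [i|x stx].
    by rewrite mem_cat => /orP[/sD|/tD].
  by split=> i is_; apply: stx; rewrite mem_cat is_ ?orbT.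
have [x [_ Gx]] := cX G GG filterT.
exists x => i Di; apply: (fcl i Di) => B; apply: Gx.
exists [:: i] => /= [j|y]; first by rewrite inE => /eqP ->.
by apply; rewrite mem_head.
Qed.

(** Every cluster point of [g @ t] has the same image as [g t] under each [f i], hence equals [g t];
    by compactness a unique cluster point is a limit. *)
Lemma continuous_of_separating (T X : topologicalType) (V : topologicalType)
    (I : Type) (D : set I) (f : I -> X -> V) (g : T -> X) :
  compact [set: X] -> hausdorff_space X -> hausdorff_space V ->
  (forall i, D i -> continuous (f i)) ->
  (forall x y, (forall i, D i -> f i x = f i y) -> x = y) ->
  (forall i, D i -> continuous (f i \o g)) -> continuous g.
Proof.
move=> cX hX hV fc fsep fg t.
apply: (@compact_cluster_set1 X (g t) (g @ t) setT) => //;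
  [exact: filterT|exact: filterT|].
have [x [_ gx]] := cX (g @ t) _ filterT.
have sub y : cluster (g @ t) y -> y = g t.
  move=> gy; apply: fsep => i Di; apply: hV => A B yA gtB.
  have [u [Bu Au]] := gy (f i @^-1` B) (f i @^-1` A) (fg i Di t B gtB)
    (fc i Di y A yA).
  by exists (f i u).
apply/seteqP; split=> y /=; first exact: sub.
by move=> ->; rewrite -(sub _ gx).
Qed.

Section rational_cuts.
Context (R : realType).
Implicit Types (c : bool * rat) (t u : R).

(** Only countably many cuts exist, so comparing real values through them keeps the families of
    closed sets countable, as closing off requires. *)
Definition cut c t : Prop := if c.1 then ratr c.2 < t else t < ratr c.2.

Definition weak_cut c t : Prop := if c.1 then ratr c.2 <= t else t <= ratr c.2.

Lemma weak_cut_of_cut c t : cut c t -> weak_cut c t.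
Proof. by case: c => -[] q /ltW. Qed.

Lemma closed_weak_cut c : closed (weak_cut c).
Proof. by case: c => -[] q; [exact: closed_ge|exact: closed_le]. Qed.

Lemma closed_not_cut c : closed [set t | ~ cut c t].
Proof.
case: c => -[] q; rewrite /cut/=.
  rewrite (_ : mkset _ = [set t | t <= ratr q]); first exact: closed_le.
  by apply/seteqP; split=> t /=; rewrite leNgt => /negP.
rewrite (_ : mkset _ = [set t | ratr q <= t]); first exact: closed_ge.
by apply/seteqP; split=> t /=; rewrite leNgt => /negP.
Qed.

(** A rational strictly between distinct [t] and [u] gives a cut met by [t] and not even weakly by
    [u]. *)
Lemma cut_eq t u : (forall c, cut c t -> weak_cut c u) -> t = u.
Proof.
move=> tu; have [ut|tlu|//] := ltgtP u t.
  have [q] := rat_in_itvoo ut; rewrite in_itv/= => /andP[uq qt].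
  have := tu (true, q) qt.
  by rewrite /weak_cut/= leNgt uq.
have [q] := rat_in_itvoo tlu; rewrite in_itv/= => /andP[uq qt].
have := tu (false, q) uq.
by rewrite /weak_cut/= leNgt qt.
Qed.

End rational_cuts.

(** The strict part of a library well-order [r]: minima of pairs and triples give antisymmetry,
    totality and transitivity. *)
Lemma well_order_exists (T : eqType) : exists lt : T -> T -> Prop,
  [/\ well_founded lt, forall a b c, lt a b -> lt b c -> lt a c &
      forall a b, [\/ lt a b, a = b | lt b a]].
Proof.
have [r wo] := wochoice.well_ordering_principle T.
have min (P : T -> Prop) : (exists x, P x) ->
    exists z, P z /\ forall x, P x -> r z x.
  move=> [x Px]; have [|z [[zP zmin] _]] := wo [pred x | `[< P x >]].
    by exists x; apply/asboolP.
  by move/asboolP: zP => Pz; exists z; split=> // y Py; apply/zmin/asboolP.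
have rr a : r a a.
  by have [|z [-> /(_ a erefl)]] := min (fun x => x = a); first by exists a.
have anti a b : r a b -> r b a -> a = b.
  move=> ab ba; have [|z [_ zu]] := wo (pred2 a b).
    by exists a; rewrite /= inE eqxx.
  transitivity z; [apply/esym|]; apply: zu; split=> [|x];
    by rewrite inE ?eqxx ?orbT// => /orP[] /eqP ->.
have tot a b : r a b \/ r b a.
  have [|z [[->|->] zmin]] := min (fun x => x = a \/ x = b).
  - by exists a; left.
  - by left; apply: zmin; right.
  - by right; apply: zmin; left.
exists (fun a b => r a b /\ a <> b); split.
- move=> a; apply: contrapT => na.
  have [|z [nz zmin]] := min (fun x => ~ Acc (fun a b => r a b /\ a <> b) x).
    by exists a.
  apply: nz; constructor => b [bz neq]; apply: contrapT => nb.
  exact/neq/anti/zmin.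
- move=> a b c [ab nab] [bc nbc]; split; last first.
    by move=> ac; apply: nab; apply: anti => //; rewrite ac.
  have [|z [[->|[->|->]] zmin]] := min (fun x => x = a \/ x = b \/ x = c).
  + by exists a; left.
  + by apply: zmin; right; right.
  + by rewrite (anti a b)//; apply: zmin; left.
  + by rewrite -(anti b c)//; apply: zmin; right; left.
- move=> a b; have [->|/eqP nab] := eqVneq a b; first by constructor 2.
  have [ab|ba] := tot a b; first by constructor 1.
  by constructor 3; split=> // /esym.
Qed.

(** * Retractions of the compact space induced by good sets *)

Section retractions_of_the_compact.
Context (R : realType) (K : topologicalType) (kappa lambda : infinite_cardinal).
Hypotheses (unc : uncountable_cardinal kappa) (reg : regular_cardinal kappa).
Hypotheses (hK : hausdorff_space K) (cK : compact [set: K]).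
Local Notation small A := (A #< [set: kappa]).
Local Notation W := {ptws nat -> Lkappa kappa lambda}.
Context (F : set W) (e : W -> K -> R).
Hypothesis eK : forall z, F z -> continuous (e z).
(** Continuity of [e] in [z] along [F], phrased with closed sets of the whole product so that
    closing off applies to them. *)
Hypothesis eF : forall x (D : set R),
  closed D -> closed [set z | F z /\ D (e z x)].
Hypothesis esep : forall x y, (forall z, F z -> e z x = e z y) -> x = y.
Implicit Types (M N S : set lambda) (z : W) (x y : K).

Local Notation nth_pt w i := (fun k : nat => w (i, k)).

(** A point of [W2] holds a sequence of points of [W], so tuples of all finite lengths share one
    countable set of coordinates. *)
Local Notation W2 := {ptws (nat * nat)%type -> Lkappa kappa lambda}.

Let nth_pt_continuous i : continuous (fun w : W2 => nth_pt w i : W).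
Proof. by apply: continuous_ptws => k; exact: ptws_eval_continuous. Qed.

Hypothesis clF : closed F.

(* Tuples of F whose values cannot meet all the cuts of l at one point of K:
   goodness for these sets is what makes x o retract M a point of K again. *)
Definition unrealizable (l : seq (bool * rat)) : set W2 :=
  [set w | (forall i, F (nth_pt w i)) /\
    forall y, exists2 i, (i < size l)%N &
      ~ cut (nth (true, 0) l i) (e (nth_pt w i) y)].

Lemma closed_unrealizable l : closed (unrealizable l).
Proof.
rewrite (_ : unrealizable l =
  (\bigcap_(i in setT) ((fun w : W2 => nth_pt w i : W) @^-1` F)) `&`
   \bigcap_(y in setT) \bigcup_(i in `I_(size l)) ((fun w : W2 => nth_pt w i : W) @^-1`
     [set z | F z /\ ~ cut (nth (true, 0) l i) (e z y)])); last first.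
  apply/seteqP; split=> w [Fw h]; split.
  - by move=> i _; exact: Fw.
  - move=> y _; have [i il ni] := h y; exists i => //; split=> //; exact: Fw.
  - by move=> i; exact: Fw.
  - by move=> y; have [i il [_ ni]] := h y I; exists i.
apply: closedI.
  by apply: closed_bigI => i _; apply: closed_preimage.
apply: closed_bigI => y _; apply: closed_bigcup => [|i _].
  exact: finite_II.
apply: closed_preimage; first exact: nth_pt_continuous.
exact: eF (@closed_not_cut R (nth (true, 0) l i)).
Qed.

Definition good_set : set (set lambda) := good unrealizable.

(** No real is both positive and negative, so the constant tuple at [z] is unrealizable for these
    two cuts; its retract is too, which includes membership in [F]. *)
Lemma good_set_retract M z : good_set M -> F z -> F (retract M \o z).
Proof.
move=> gM Fz.
have := @good_retract _ _ unc _ _ _ closed_unrealizable M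
  [:: (true, 0); (false, 0)] (fun ij => z ij.2) gM.
case=> [|/(_ 0%N) //]; split=> // y.
have [e0|e0] := boolP (0 < e z y); [exists 1%N => //|exists 0%N => //];
  rewrite /cut/= rmorph0.
  by apply/negP; rewrite -leNgt ltW.
exact/negP.
Qed.

(** By compactness it suffices to meet finitely many cuts of the desired values weakly. If no point
    did, the tuple involved would be unrealizable, and so would its retract, whose cuts [x]
    meets. *)
Lemma retract_point M x : good_set M ->
  exists y, forall z, F z -> e z y = e (retract M \o z) x.
Proof.
move=> gM.
pose D : set (W * (bool * rat)) :=
  [set c | F c.1 /\ cut c.2 (e (retract M \o c.1) x)].
have [c [Fc _]|s sD|y yP] := @compact_seq_inter K _ D
  (fun c => [set y | weak_cut c.2 (e c.1 y)]) cK.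
- by apply: closed_preimage; [exact: eK|exact: closed_weak_cut].
- apply: contrapT => nex; case: s sD nex => [|c0 s'].
    by move=> _; apply; exists x.
  set s := c0 :: s' => sD nex.
  (* Padding by [c0] keeps the whole infinite tuple in [F]. *)
  have Ds i : D (nth c0 s i).
    have [si|si] := ltnP i (size s); first by apply: sD; exact: mem_nth.
    by rewrite nth_default//; apply: sD; rewrite mem_head.
  have := @good_retract _ _ unc _ _ _ closed_unrealizable M
    (map snd s) (fun ij => (nth c0 s ij.1).1 ij.2) gM.
  case=> [|_ /(_ x)[i]]; last first.
    by rewrite size_map => si; rewrite (nth_map c0)//; have [_] := Ds i.
  split=> [i|y]; first by have [] := Ds i.
  apply: contrapT => ncut; apply: nex; exists y => c /(nthP c0)[i si <-].
  apply: weak_cut_of_cut; apply: contrapT => nc; apply: ncut.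
  by exists i; rewrite ?size_map// (nth_map c0).
- exists y => z Fz; apply/esym/cut_eq => c cz; exact: (yP (z, c)).
Qed.

(** By [esep] at most one [y] qualifies, and for good [M] one exists; the default [x] serves only
    other [M]. *)
Definition retraction M : K -> K := fun x =>
  xget x [set y | forall z, F z -> e z y = e (retract M \o z) x].

Lemma retractionE M x z : good_set M -> F z ->
  e z (retraction M x) = e (retract M \o z) x.
Proof.
move=> gM; rewrite /retraction; case: xgetP => [y _|nex]; first exact.
by have [y] := retract_point x gM => /nex.
Qed.

Lemma retraction_eq M x y : good_set M ->
  (retraction M x = retraction M y <->
   forall z, F z -> e (retract M \o z) x = e (retract M \o z) y).
Proof.
move=> gM; split=> [xy z Fz|h]; first by rewrite -!retractionE// xy.
by apply: esep => z Fz; rewrite !retractionE// h.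
Qed.

Lemma retraction_idem M x :
  good_set M -> retraction M (retraction M x) = retraction M x.
Proof.
move=> gM; apply: esep => z Fz.
rewrite !retractionE//; last exact: good_set_retract.
by congr (e _ x); apply/funext => k /=; rewrite retractI setIid.
Qed.

Lemma retractionT x : retraction setT x = x.
Proof.
apply: esep => z Fz; rewrite retractionE//.
by congr (e _ x); apply/funext => k /=; rewrite retractT.
Qed.

Lemma retraction_continuous M : good_set M -> continuous (retraction M).
Proof.
move=> gM; apply: (continuous_of_separating (D := F) (f := e)) => //.
move=> z Fz; rewrite (_ : _ \o _ = e (retract M \o z)).
  by apply: eK; exact: good_set_retract.
by apply/funext => x /=; rewrite retractionE.
Qed.

(** Closing off the empty set for the countably many sets [C c] preserves the failure of each cut at
    [x], hence the value. Every [z] in [F] fails one of the two strict cuts at 0, so membership in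
    [F] is preserved too. *)
Lemma small_support x : exists2 M : set lambda, small M &
  forall z, F z -> F (retract M \o z) /\ e (retract M \o z) x = e z x.
Proof.
pose C (c : bool * rat) : set W := [set z | F z /\ ~ cut c (e z x)].
have clC c : closed (C c) by exact: eF (@closed_not_cut R c).
exists (smallest (good C) set0).
  by apply: small_smallest => //; apply: small_finite.
move=> z Fz; have Cr c : C c z -> C c (retract (smallest (good C) set0) \o z).
  by apply: good_retract => //; exact: good_smallest.
split.
  have [zc|zc] := pselect (cut (true, 0) (e z x)).
    suff /Cr[] : C (false, 0) z by [].
    split=> //; move: zc; rewrite /cut/= rmorph0 => /lt_trans h /h.
    by rewrite ltxx.
  by suff /Cr[] : C (true, 0) z by [].
apply: cut_eq => c cz; apply: contrapT => nc.
have : C c z by split=> // /weak_cut_of_cut/nc.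
by move=> /Cr[_].
Qed.

(** Retracting further to [S] leaves values at [x] unchanged, so a good set acts on [x] through its
    trace on [S]. *)
Lemma retraction_support x M N S : good_set M -> good_set N ->
  (forall z, F z -> F (retract S \o z) /\ e (retract S \o z) x = e z x) ->
  M `&` S = N `&` S -> retraction M x = retraction N x.
Proof.
move=> gM gN Sx MN; apply: esep => z Fz; rewrite !retractionE//.
have aux M' : good_set M' ->
    e (retract M' \o z) x = e (retract (M' `&` S) \o z) x.
  move=> gM'; have [_ <-] := Sx _ (good_set_retract gM' Fz).
  by congr (e _ x); apply/funext => k /=; rewrite retractI setIC.
by rewrite aux// MN -aux.
Qed.

(** By [cut_eq], equality means that every cut fails at [x] or holds weakly at [y]; both
    alternatives are closed. *)
Lemma closed_agree x y : closed [set z | F z /\ e z x = e z y].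
Proof.
pose A c := [set z | F z /\ ~ cut c (e z x)].
pose B c := [set z | F z /\ weak_cut c (e z y)].
rewrite (_ : mkset _ = \bigcap_c (A c `|` B c)).
  apply: closed_bigI => c _; apply: closedU.
    exact: eF (@closed_not_cut R c).
  exact: eF (@closed_weak_cut R c).
apply/seteqP; split=> z.
  move=> [Fz zxy] c _; have [cz|cz] := pselect (cut c (e z x)); last by left.
  by right; split=> //; rewrite -zxy; exact: weak_cut_of_cut.
move=> h; have {}h c : A c z \/ B c z by exact: h.
split; first by case: (h (true, 0)) => -[].
by apply: cut_eq => c cz; case: (h c) => -[_]; first by move=> /(_ cz).
Qed.

(* Along an increasing union of good sets the retractions converge pointwise. *)
Lemma retraction_bigcup (G : set (set lambda)) x y :
  G !=set0 -> G `<=` good_set ->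
  (forall M N, G M -> G N -> M `<=` N \/ N `<=` M) ->
  (forall M, G M -> retraction M x = retraction M y) ->
  retraction (\bigcup_(M in G) M) x = retraction (\bigcup_(M in G) M) y.
Proof.
move=> G0 Gg Gtot Gxy; set U := \bigcup_(M in G) M.
have gU : good_set U by exact: good_directed.
apply/retraction_eq => // z Fz.
(* Tail filter of the chain: each coordinate of [retract N \o z] is eventually constant along it. *)
pose H := filter_from G (fun M => [set N | G N /\ M `<=` N]).
have HH : ProperFilter H.
  apply: filter_from_proper => [|M GM]; last by exists M; split.
  apply: filter_from_filter => // M N GM GN.
  have [MN|NM] := Gtot _ _ GM GN; [exists N => //|exists M => //] => P [GP].
    by move=> NP; split; split=> // a /MN /NP.
  by move=> MP; split; split=> // a /NM /MP.
pose rz N : W := retract N \o z.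
suff rzU : rz @ H --> rz U.
  have [_ //] : [set z' | F z' /\ e z' x = e z' y] (rz U).
  apply: (closed_filter_cvg (@closed_agree x y) _ _ rzU).
  have [M GM] := G0; exists M => // N [GN _] /=; split.
    exact: good_set_retract (Gg _ GN) Fz.
  by have /retraction_eq h := Gxy _ GN; exact: h (Gg _ GN) _ Fz.
apply: ptws_cvg => k A Ak; rewrite nbhs_simpl /=.
have [[a [zk [M GM Ma]]]|nz] := pselect (exists a, z k = Some a /\ U a).
  exists M => // N [GN MN] /=; apply: nbhs_singleton.
  rewrite (_ : rz N k = rz U k)// /rz /=.
  transitivity (Some a); first by apply/retract_Some; split=> //; exact: MN.
  by apply/esym/retract_Some; split=> //; exists M.
have [M GM] := G0; exists M => // N [GN _] /=; apply: nbhs_singleton.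
rewrite (_ : rz N k = rz U k)// /rz /=.
have rN V : V `<=` U -> retract V (z k) = None.
  move=> VU; case E: (retract V (z k)) => [a|//].
  by move/retract_Some: E => [zk /VU Ua]; case: nz; exists a.
by rewrite !rN// => a Na; exists N.
Qed.

(* Since the points of M are isolated in L_kappa(M) when M is small, the
   retract of F to M has a small dense subset. *)
Lemma retraction_small M : small M -> good_set M ->
  exists2 D : set W, small D & D `<=` F /\
    forall x y, (forall z, D z -> e z x = e z y) ->
      retraction M x = retraction M y.
Proof.
move=> sM gM.
pose o0 : Lkappa kappa lambda := None.
pose FM := [set z | F z /\ retract M \o z = z].
pose ext s : set W :=
  [set z | FM z /\ forall k, (k < size s)%N -> z k = nth o0 s k].
pose S := [set s : seq (Lkappa kappa lambda) |
  {in s, forall o, (Some @` M `|` [set o0]) o}].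
have sS : small S.
  apply: small_seq => //; apply: small_setU; first exact: small_image.
  by apply: small_finite unc _ _ _; exact: finite_set1.
have [[z0 FMz0]|FM0] := pselect (exists z, FM z); last first.
  exists set0; first exact: small_finite unc _ _ (finite_set0 _).
  split=> // x y _; apply/retraction_eq => // z Fz.
  case: FM0; exists (retract M \o z); split; first exact: good_set_retract.
  by apply/funext => k /=; rewrite retractI setIid.
(* One point of [FM] for each finite initial segment; [z0] serves segments without extension in
   [FM]. *)
pose d s := xget z0 (ext s).
have FMd s : FM (d s) by rewrite /d; case: xgetP => // z _ [].
exists (d @` S); first exact: small_image.
split=> [_ [s _ <-]|x y dxy]; first by have [] := FMd s.
apply/retraction_eq => // z Fz; set z' : W := retract M \o z.
pose dz n := d (mkseq z' n).
have dzE n k : (k < n)%N -> dz n k = z' k.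
  move=> kn; have [_ ->] : ext (mkseq z' n) (dz n);
    rewrite ?size_mkseq ?nth_mkseq//.
  apply: (xgetPex z0); exists z'; split=> [|j]; last first.
    by rewrite size_mkseq => jn; rewrite nth_mkseq.
  split; first exact: good_set_retract.
  by apply/funext => j /=; rewrite retractI setIid.
have dzz' : dz @ \oo --> z'.
  apply: ptws_cvg => k A Ak; exists k.+1 => // n /= kn.
  by rewrite dzE//; exact: nbhs_singleton.
have [_ //] : [set z' | F z' /\ e z' x = e z' y] z'.
apply: (closed_filter_cvg (@closed_agree x y) _ _ dzz').
exists 0%N => // n _ /=; split; first by have [] := FMd (mkseq z' n).
apply: dxy; exists (mkseq z' n) => // o /mapP[k _ ->].
case E: (z' k) => [a|]; last by right.
by left; exists a => //; have /retract_Some[] := E.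
Qed.

(** * Separating families by transfinite induction *)

Local Notation gen := (smallest good_set).

Let good_gen S : good_set (gen S). Proof. exact: good_smallest. Qed.

Let gen_sub S S' : S `<=` S' -> gen S `<=` gen S'.
Proof.
move=> SS'; apply: smallest_sub; first exact: good_gen.
by apply: subset_trans SS' _; exact: sub_smallest.
Qed.

(** A relative form of the goal, suited to induction on [S]: the case [setT] is the goal itself,
    since [retraction setT] is the identity. *)
Definition separating S : Prop := exists H : set (K -> R),
  [/\ forall h, H h -> continuous h,
      forall x, small [set h | H h /\ h x <> 0] &
      forall x y, (forall h, H h -> h x = h y) ->
        retraction (gen S) x = retraction (gen S) y].

Lemma separating_small S : small S -> separating S.
Proof.
move=> sS; have sg : small (gen S) by exact: small_smallest.
have [D sD [DF Dsep]] := retraction_small sg (@good_gen S).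
exists (e @` D); split=> [_ [z Dz <-]|x|x y exy].
- by apply: eK; exact: DF.
- by apply: small_sub (small_image e sD) => h [].
- by apply: Dsep => z Dz; apply: exy; exists z.
Qed.

(** Agreement of two points passes from [below s] to [upto s] through the differences at [s], and
    through unions of the chain by [retraction_bigcup]. *)
Lemma separating_step S (prec : lambda -> lambda -> Prop) :
  well_founded prec ->
  (forall a b c, prec a b -> prec b c -> prec a c) ->
  (forall a b, S a -> S b -> [\/ prec a b, a = b | prec b a]) ->
  (forall s, S s -> separating [set t | S t /\ (prec t s \/ t = s)]) ->
  separating S.
Proof.
move=> wf tr tot Ssep.
pose below s := gen [set t | S t /\ prec t s].
pose upto s := gen [set t | S t /\ (prec t s \/ t = s)].
have gb s : good_set (below s) by exact: good_gen.
have gu s : good_set (upto s) by exact: good_gen.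
have ub s t : prec s t -> upto s `<=` below t.
  move=> st; apply: gen_sub => a [Sa as_]; split=> //=.
  by case: as_ => [as_|-> //]; exact: tr as_ st.
have bu s : below s `<=` upto s.
  by apply: gen_sub => a [Sa as_]; split=> //; left.
have s0 : small (@set0 lambda) by exact: small_finite.
(* The bottom [gen set0] of the chain gets a family of its own. *)
have [H0 [H0c H0s H0sep]] := separating_small s0.
have /choice[H HP] : forall s, exists H : set (K -> R), S s ->
    [/\ forall h, H h -> continuous h,
      forall x, small [set h | H h /\ h x <> 0] &
      forall x y, (forall h, H h -> h x = h y) ->
        retraction (upto s) x = retraction (upto s) y].
  move=> s; have [/Ssep[Hs HsP]|nS] := pselect (S s); first by exists Hs.
  by exists set0.
pose diff s (h : K -> R) : K -> R :=
  fun x => h (retraction (upto s) x) - h (retraction (below s) x).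
exists (H0 `|` \bigcup_(s in S) (diff s @` H s)); split.
- move=> h [/H0c//|[s Ss [g Hg <-]]] x.
  have [/(_ g Hg) cg _ _] := HP _ Ss.
  by apply: cvgB; apply: continuous_comp; try exact: cg;
    exact: retraction_continuous.
- move=> x; have [Q sQ Qx] := small_support x.
  pose T := [set s | S s /\ retraction (upto s) x <> retraction (below s) x].
  have sT : small T.
    apply: card_le_lt_trans sQ.
    (* By [retraction_support], the two retractions differ at [x] only if a point of [Q] enters
       between [below s] and [upto s]; these layers are disjoint for distinct [s]. *)
    apply: (@card_le_graph _ _ _ _ (fun s a => upto s a /\ ~ below s a)).
      move=> s [Ss ns]; apply: contrapT => nex; apply: ns.
      apply: (retraction_support _ _ Qx) => //.
      apply/seteqP; split=> a [Ma Qa]; split=> //; last exact: bu.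
      by apply: contrapT => nb; apply: nex; exists a.
    move=> s t a [Ss _] [St _] [us nbs] [ut nbt].
    have [st|//|ts] := tot _ _ Ss St.
      by case: nbt; exact: ub us.
    by case: nbs; exact: ub ut.
  have := small_setU (H0s x) (small_bigcup reg sT (fun s (Ts : T s) =>
    small_image (diff s) (let: And3 _ h _ := HP s Ts.1 in
    small_setU (h (retraction (upto s) x)) (h (retraction (below s) x))))).
  apply: small_sub => h [[H0h|[s Ss [g Hg gh]]] hx]; [by left|subst h].
  right; exists s.
    by split=> // ux; apply: hx; rewrite /diff ux subrr.
  exists g => //; have [ux|ux] := eqVneq (g (retraction (upto s) x)) 0.
    by right; split=> // bx; apply: hx; rewrite /diff ux bx subrr.
  by left; split=> //; exact/eqP.
- move=> x y Hxy.
  (* For an initial segment [T], [gen T] is the union of the chain [G], which [gen set0] keeps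
     nonempty. This serves both for [below s] and for [S]. *)
  have limit (T : set lambda) : T `<=` S ->
      (forall s t, T t -> S s -> prec s t -> T s) ->
      (forall t, T t -> retraction (upto t) x = retraction (upto t) y) ->
      retraction (gen T) x = retraction (gen T) y.
    move=> TS Tdown Txy.
    pose G := [set gen set0] `|` upto @` T.
    have Gg : G `<=` good_set by move=> _ [->|[t _ <-]].
    have Gtot M N : G M -> G N -> M `<=` N \/ N `<=` M.
      have G0 P : G P -> gen set0 `<=` P.
        by move=> [->//|[u _ <-]]; exact: gen_sub.
      move=> [->|[s Ts <-]]; first by move=> /G0; left.
      move=> [->|[t Tt <-]]; first by right; exact: gen_sub.
      have [st|->|ts] := tot _ _ (TS _ Ts) (TS _ Tt).
      - by left; exact: subset_trans (ub _ _ st) (bu _).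
      - by left.
      - by right; exact: subset_trans (ub _ _ ts) (bu _).
    have G0 : G !=set0 by exists (gen set0); left.
    rewrite (_ : gen T = \bigcup_(M in G) M).
      apply: retraction_bigcup => // M [->|[t Tt <-]]; last exact: Txy.
      by apply: H0sep => h H0h; apply: Hxy; left.
    apply/seteqP; split.
      apply: smallest_sub; first exact: good_directed.
      move=> t Tt; exists (upto t); first by right; exists t.
      suff : [set u | S u /\ (prec u t \/ u = t)] t by exact: sub_smallest.
      by split; [exact: TS|right].
    move=> a [M [->|[t Tt <-]]]; apply: gen_sub => // u [Su [ut|->//]].
    exact: Tdown ut.
  have up s : S s -> retraction (upto s) x = retraction (upto s) y.
    elim/(well_founded_ind wf): s => s ih Ss.
    have bxy : retraction (below s) x = retraction (below s) y.
      apply: limit => [t []//|t u [Su us] St tu|t [St ts]].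
        by split=> //; exact: tr us.
      exact: ih.
    have [_ _ Hsep] := HP _ Ss.
    (* Separation is applied at the images under [retraction (upto s)]: there the values of [h]
       follow from [diff s h] and the agreement on [below s]. *)
    rewrite -(retraction_idem x (gu s)) -(retraction_idem y (gu s)).
    apply: Hsep => h Hh; have : diff s h x = diff s h y.
      by apply: Hxy; right; exists s => //; exists h.
    by rewrite /diff bxy => /addIr.
  exact: limit.
Qed.

(** Induction over the initial segments of a well-order of [lambda]: a set injecting into one is
    ordered by pullback, and its own proper segments inject into shorter ones. *)
Theorem separatingT : separating setT.
Proof.
have [lt [wf tr tot]] := well_order_exists lambda.
have step (A : set lambda) (f : lambda -> lambda) : {in A &, injective f} ->
    (forall s, A s -> forall B : set lambda,
      B #<= [set b | lt b (f s)] -> separating B) ->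
    separating A.
  move=> fi Hs; apply: (separating_step (prec := fun s t => lt (f s) (f t))).
  - exact: Inverse_Image.wf_inverse_image.
  - by move=> a b c; exact: tr.
  - move=> a b Aa Ab; have [ab|ab|ba] := tot (f a) (f b); last by constructor 3.
      by constructor 1.
    by constructor 2; apply: fi => //; exact/mem_set.
  - move=> s As; set B := mkset _.
    have BU : B `<=` [set t | A t /\ lt (f t) (f s)] `|` [set s].
      by move=> t [At [ts|->]]; [left|right].
    have BI : [set t | A t /\ lt (f t) (f s)] #<= [set b | lt b (f s)].
      apply: (@card_le_graph _ _ _ _ (fun t b => b = f t)) => [t [At ts]|].
        by exists (f t).
      by move=> t u _ [At _] [Au _] -> /fi; apply; exact/mem_set.
    (* [B] contains [s] as well as its predecessors; an infinite segment absorbs this extra point,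
       and a finite one leaves [B] small. *)
    have [fin|inf] := pselect (finite_set [set b | lt b (f s)]).
      apply: separating_small; apply: small_finite => //.
      apply: sub_finite_set BU _; rewrite finite_setU; split=> //.
      exact: card_le_finite BI fin.
    apply: (Hs s As); apply: card_le_trans (subset_card_le BU) _.
    apply: card_le_setU => //; apply: card_le_trans (iffLR (infiniteP _) inf).
    exact: finite_set_countable.
have key a : forall A : set lambda, A #<= [set b | lt b a] -> separating A.
  elim/(well_founded_ind wf): a => a ih A /card_leP/injfunPex[f fA finj].
  pose g t :=
    if pselect (A t) is left At then set_val (f (SigSub (mem_set At))) else t.
  have gA t : A t -> lt (g t) a.
    by rewrite /g; case: pselect => // At _; exact: (set_valP (f _)).
  have gi : {in A &, injective g}.
    move=> t u /set_mem At /set_mem Au; rewrite /g.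
    case: pselect => // At'; case: pselect => // Au' /val_inj.
    by move=> /(finj _ _ (mem_setT _) (mem_setT _))/(congr1 set_val).
  by apply: (step A g gi) => s As; apply: ih; exact: gA.
by apply: (step setT id) => [|s _]; [move=> ? ? _ _|exact: key].
Qed.

Theorem separating_family : exists H : set (K -> R),
  [/\ forall h, H h -> continuous h,
      forall x, small [set h | H h /\ h x <> 0] &
      forall x y, (forall h, H h -> h x = h y) -> x = y].
Proof.
have [H [Hc Hs Hsep]] := separatingT; exists H; split=> // x y /Hsep.
rewrite (_ : gen setT = setT) ?retractionT//.
by apply/seteqP; split=> // a _ M [_]; exact.
Qed.

End retractions_of_the_compact.

(** * From an image of a closed set to Corson compactness *)

Lemma continuous_to_subtype (X Y : topologicalType) (A : set Y)
    (f : X -> set_type A) : continuous (set_val \o f) -> continuous f.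
Proof.
move=> cf x B [_ [[C oC <-] Cfx] CB].
by apply: filterS CB _; apply: cf; exact: open_nbhs_nbhs.
Qed.

Lemma set_val_continuous (Y : topologicalType) (A : set Y) :
  continuous (set_val : set_type A -> Y).
Proof. exact: initial_continuous. Qed.

Lemma tychonoff_separates (R : realType) (K : topologicalType) (x y : K) :
  tychonoff_space K -> (forall f : K -> R, continuous f -> f x = f y) -> x = y.
Proof.
move=> [hK rK] fxy; apply: contrapT => xy.
have cly : closed [set y].
  exact: accessible_closed_set1 (hausdorff_accessible hK) y.
have /(@uniform_separatorP _ R)[f [cf _ f0 f1]] := rK x [set y] cly xy.
have := fxy f cf; rewrite (f0 (f x))//; last by exists x.
by rewrite (f1 (f y))//; [move=> /esym/eqP; rewrite oner_eq0|exists y].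
Qed.

(** Evaluation embeds [K] in the power of [R] indexed by [H]; its inverse is continuous because each
    [h] composed with it is a coordinate projection. *)
Lemma Corson_of_separating (R : realType) (K : topologicalType)
    (kappa : infinite_cardinal) (H : set (K -> R)) :
  tychonoff_space K -> compact [set: K] -> (forall h, H h -> continuous h) ->
  (forall x, [set h | H h /\ h x <> 0] #< [set: kappa]) ->
  (forall x y, (forall h, H h -> h x = h y) -> x = y) ->
  Corson_compact R kappa K.
Proof.
move=> tK cK Hc Hs Hsep; split=> //.
pose i x : {ptws set_type H -> R} := fun h => set_val h x.
have ii x y : i x = i y -> x = y.
  move=> ixy; apply: Hsep => h Hh.
  exact: (congr1 (fun g => g (SigSub (mem_set Hh))) ixy).
have ci : continuous i.
  by apply: continuous_ptws => h; apply: Hc; exact: set_valP.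
exists (set_type H), (range i); split.
  move=> _ [x _ <-]; apply: card_le_lt_trans (Hs x).
  apply: (@card_le_graph _ _ _ _ (fun h g => g = set_val h)).
    by move=> h hx; exists (set_val h) => //; split=> //; exact: set_valP.
  by move=> h h' _ _ _ -> /val_inj.
pose f x : set_type (range i) := SigSub (mem_set (ex_intro2 _ _ x I erefl)).
have /choice[g gP] : forall a : set_type (range i), exists x, i x = set_val a.
  by move=> a; have [x _ xa] := set_valP a; exists x.
have fg : cancel g f by move=> a; apply: val_inj; rewrite /= gP.
have gf : cancel f g by move=> x; apply: ii; rewrite gP.
exists f, g; split=> //; first exact: continuous_to_subtype.
apply: (@continuous_of_separating _ _ _ _ H (fun h x => h x) g cK tK.1) => //.
move=> h Hh; pose hh : set_type H := SigSub (mem_set Hh).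
rewrite (_ : _ \o g = (fun w : {ptws set_type H -> R} => w hh) \o set_val).
  move=> a; apply: continuous_comp; first exact: set_val_continuous.
  exact: ptws_eval_continuous.
by apply/funext => a; exact: (congr1 (fun w => w hh) (gP a)).
Qed.

Lemma Corson_of_Lkappa (R : realType) (K : topologicalType)
    (kappa : infinite_cardinal) :
  tychonoff_space K -> compact [set: K] ->
  uncountable_cardinal kappa -> regular_cardinal kappa ->
  in_Lkappa_class kappa (Cp R K) -> Corson_compact R kappa K.
Proof.
move=> tK cK unc reg [_ [lambda [F [clF [phi [cphi phis]]]]]].
pose e z x : R :=
  if pselect (F z) is left Fz then set_val (phi (SigSub (mem_set Fz))) x else 0.
have eE z (Fz : F z) x : e z x = set_val (phi (SigSub (mem_set Fz))) x.
  rewrite /e; case: pselect => // Fz'.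
  by congr (set_val (phi _) x); exact: val_inj.
have [|||//|H [Hc Hs Hsep]] :=
  @separating_family R K kappa lambda unc reg tK.1 cK F e.
- move=> z Fz x; rewrite (_ : e z = set_val (phi (SigSub (mem_set Fz)))).
    exact: (set_valP (phi (SigSub (mem_set Fz)))).
  by apply/funext => y; exact: eE.
- move=> x D clD.
  pose g (z : set_type F) : R := set_val (phi z) x.
  have cg : continuous g.
    move=> z; apply: (continuous_comp (f := set_val \o phi)
      (g := fun w : {ptws K -> R} => w x)); last exact: ptws_eval_continuous.
    by apply: continuous_comp; [exact: cphi|exact: set_val_continuous].
  have [V oV VE] : open (~` (g @^-1` D)).
    by apply: closed_openC; exact: closed_preimage.
  rewrite (_ : mkset _ = F `&` ~` V).
    by apply: closedI => //; exact: open_closedC.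
  have VD z (Fz : F z) : V z <-> ~ D (e z x).
    rewrite eE; have := congr1 (fun A => A (SigSub (mem_set Fz))) VE.
    by rewrite /preimage /= => ->.
  apply/seteqP; split=> z [Fz Dz]; split=> //.
    by move/VD => /(_ Fz).
  by apply: contrapT => nD; apply: Dz; apply/VD.
- move=> x y exy; apply: (tychonoff_separates (R := R) tK) => f cf.
  have : range phi (SigSub (mem_set cf)) by rewrite phis.
  move=> [z _ zf]; have Fz : F (set_val z) := set_valP z.
  have := exy _ Fz; rewrite !eE.
  by rewrite (_ : SigSub _ = z) ?zf//; exact: val_inj.
- exact: Corson_of_separating Hc Hs Hsep.
Qed.

Lemma Cp_tychonoff (R : realType) (X : topologicalType) :
  tychonoff_space (Cp R X).
Proof.
split; last exact: uniform_completely_regular.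
move=> f g fg; apply: val_inj; apply/funext => x.
apply: Rhausdorff => A B Af Bg.
pose ev (h : Cp R X) : R := set_val h x.
have cev : continuous ev.
  move=> h; apply: (continuous_comp (f := set_val)
    (g := fun w : {ptws X -> R} => w x)); last exact: ptws_eval_continuous.
  exact: set_val_continuous.
have [h [Ah Bh]] := fg _ _ (cev f A Af) (cev g B Bg).
by exists (ev h).
Qed.

Lemma compact_seq_cover (X : topologicalType) (I : eqType) (U : I -> set X) :
  compact [set: X] -> (forall i, open (U i)) -> (forall x, exists i, U i x) ->
  exists s : seq I, forall x, exists2 i, i \in s & U i x.
Proof.
move=> cX oU covU; apply: contrapT => nex.
have [|s _|x xU] := @compact_seq_inter X I setT (fun i => ~` U i) cX.
- by move=> i _; exact: open_closedC.
- apply: contrapT => ns; apply: nex; exists s => x.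
  apply: contrapT => nx; apply: ns; exists x => i is_ Uix.
  by apply: nx; exists i.
- by have [i Uix] := covU x; exact: (xU i Logic.I Uix).
Qed.

(** * Geometrically fast convergence *)

Section geometric_limits.
Context (R : realType).

(** [2 * 2^-1 ^+ n] is the sum of the remaining steps, so subtracting or adding it to [u n] gives
    monotone bounds that enclose the limit. *)
Lemma geometric_limit (u : nat -> R) :
  (forall n, `|u n - u n.+1| <= 2^-1 ^+ n) ->
  exists l, forall n, `|u n - l| <= 2 * 2^-1 ^+ n.
Proof.
move=> du.
pose a n := u n - 2 * 2^-1 ^+ n; pose b n := u n + 2 * 2^-1 ^+ n.
have step n : 2 * 2^-1 ^+ n.+1 = 2^-1 ^+ n :> R.
  by rewrite exprS mulrA divff ?mul1r.
have aS n : a n <= a n.+1.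
  have := du n; rewrite ler_norml => /andP[_].
  by rewrite /a step; set t := _ ^+ n; lra.
have bS n : b n.+1 <= b n.
  have := du n; rewrite ler_norml => /andP[+ _].
  by rewrite /b step; set t := _ ^+ n; lra.
have ab m n : a m <= b n.
  have amono := (nondecreasing_seqP a).1 aS.
  have bmono := (nonincreasing_seqP b).1 bS.
  apply: le_trans (amono _ _ (leq_maxl m n)) _.
  apply: le_trans (bmono _ _ (leq_maxr m n)).
  rewrite /a /b; have : 0 <= 2^-1 ^+ (maxn m n) :> R by rewrite exprn_ge0.
  by set t := _ ^+ _; lra.
have sa : has_sup (range a).
  split; first by exists (a 0%N); exists 0%N.
  by exists (b 0%N) => _ [n _ <-].
exists (sup (range a)) => n; rewrite ler_norml.
have an : a n <= sup (range a) by apply: ub_le_sup; [exact: sa.2|exists n].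
have bn : sup (range a) <= b n.
  by apply: ge_sup; [exact: sa.1|move=> _ [m _ <-]].
by move: an bn; rewrite /a /b; set t := 2 * _; lra.
Qed.

Lemma geometric_small (e : R) : 0 < e -> exists n, 2 * 2^-1 ^+ n < e.
Proof.
move=> e0; have h : `|2^-1 : R| < 1 by rewrite ger0_norm ?invf_lt1 ?ltr1n.
have /cvgrPdist_lt/(_ e e0) [n _ /(_ n (leqnn n))] := cvg_geometric 2 h.
by rewrite sub0r normrN /geometric/= => /(le_lt_trans (ler_norm _)); exists n.
Qed.

Lemma continuous_geometric_limit (T : topologicalType) (u : nat -> T -> R)
    (l : T -> R) : (forall n, continuous (u n)) ->
  (forall n t, `|u n t - l t| <= 2 * 2^-1 ^+ n) -> continuous l.
Proof.
move=> cu ul t; apply/cvgrPdist_lt => e e0.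
have [n ne] : exists n, 2 * 2^-1 ^+ n < e / 3 by apply: geometric_small; lra.
have /cvgrPdist_lt/(_ (e / 3)) := cu n t.
have -> : 0 < e / 3 by lra.
move=> /(_ isT); apply: filterS => s.
have := ul n t; have := ul n s; rewrite !ler_norml !ltr_norml.
move: ne; set p := 2 * _; move=> ne /andP[? ?] /andP[? ?] /andP[? ?].
by apply/andP; split; lra.
Qed.

End geometric_limits.

(* Codes for the functions max_i min_j (a_ij phi_ij + b_ij) with rational
   coefficients; the coefficients come first, the index of phi_ij last. *)
Section lattice_terms.

Definition affine_term (X : Type) := (rat * rat * X)%type.
(** Head and tail of a nonempty list, so that the minimum needs no neutral element; likewise for the
    maximum below. *)
Definition row_term (X : Type) := (affine_term X * seq (affine_term X))%type.
Definition lattice_term (X : Type) := (row_term X * seq (row_term X))%type.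

Definition map_row (X Y : Type) (g : X -> Y) (r : row_term X) : row_term Y :=
  let f p := (p.1, g p.2) in (f r.1, map f r.2).

Definition map_term (X Y : Type) (g : X -> Y) (t : lattice_term X) :
  lattice_term Y := (map_row g t.1, map (map_row g) t.2).

Context (R : realType).

Definition affine_val X (v : X -> R) (p : affine_term X) : R :=
  ratr p.1.1 * v p.2 + ratr p.1.2.

Definition row_val X (v : X -> R) (r : row_term X) : R :=
  foldr (fun p m => Num.min (affine_val v p) m) (affine_val v r.1) r.2.

Definition term_val X (v : X -> R) (t : lattice_term X) : R :=
  foldr (fun r m => Num.max (row_val v r) m) (row_val v t.1) t.2.

Lemma row_val_map X Y (g : X -> Y) (v : Y -> R) r :
  row_val v (map_row g r) = row_val (v \o g) r.
Proof. by rewrite /row_val foldr_map. Qed.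

Lemma term_val_map X Y (g : X -> Y) (v : Y -> R) t :
  term_val v (map_term g t) = term_val (v \o g) t.
Proof.
rewrite /term_val foldr_map row_val_map; elim: t.2 => //= r s ->.
by rewrite row_val_map.
Qed.

Lemma row_val_le (X : eqType) (v : X -> R) (r : row_term X) p :
  p \in r.1 :: r.2 -> row_val v r <= affine_val v p.
Proof.
rewrite /row_val; elim: r.2 => [|q s ih] /=; first by rewrite inE => /eqP ->.
rewrite !inE orbCA ge_min => /orP[/eqP ->|ps]; first by rewrite lexx.
by rewrite ih ?orbT// inE.
Qed.

Lemma row_val_gt (X : eqType) (v : X -> R) (r : row_term X) m :
  {in r.1 :: r.2, forall p, m < affine_val v p} -> m < row_val v r.
Proof.
rewrite /row_val; elim: r.2 => [|q s ih] /= h; first by apply: h; rewrite inE.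
rewrite lt_min h ?ih ?inE ?eqxx ?orbT// => p.
by rewrite inE => ps; apply: h; rewrite !inE orbCA ps orbT.
Qed.

Lemma term_val_ge (X : eqType) (v : X -> R) (t : lattice_term X) r :
  r \in t.1 :: t.2 -> row_val v r <= term_val v t.
Proof.
rewrite /term_val; elim: t.2 => [|q s ih] /=; first by rewrite inE => /eqP ->.
rewrite !inE orbCA le_max => /orP[/eqP ->|ps]; first by rewrite lexx.
by rewrite ih ?orbT// inE.
Qed.

Lemma term_val_lt (X : eqType) (v : X -> R) (t : lattice_term X) m :
  {in t.1 :: t.2, forall r, row_val v r < m} -> term_val v t < m.
Proof.
rewrite /term_val; elim: t.2 => [|q s ih] /= h; first by apply: h; rewrite inE.
rewrite gt_max h ?ih ?inE ?eqxx ?orbT// => p.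
by rewrite inE => ps; apply: h; rewrite !inE orbCA ps orbT.
Qed.

Lemma continuous_affine_val (T : topologicalType) X (v : T -> X -> R) p :
  (forall k, continuous (v^~ k)) -> continuous (fun t => affine_val (v t) p).
Proof.
move=> cv t; apply: cvgD; last exact: cvg_cst.
by apply: cvgM; [exact: cvg_cst|exact: cv].
Qed.

Lemma continuous_row_val (T : topologicalType) X (v : T -> X -> R) r :
  (forall k, continuous (v^~ k)) -> continuous (fun t => row_val (v t) r).
Proof.
move=> cv; rewrite /row_val; elim: r.2 => [|q s ih]/=.
  exact: continuous_affine_val.
move=> t; apply: (@continuous_min R T (fun t => affine_val (v t) q)
    (fun t => foldr _ _ s)); [exact: continuous_affine_val|exact: ih].
Qed.

Lemma continuous_term_val (T : topologicalType) X (v : T -> X -> R) w :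
  (forall k, continuous (v^~ k)) -> continuous (fun t => term_val (v t) w).
Proof.
move=> cv; rewrite /term_val; elim: w.2 => [|q s ih]/=.
  exact: continuous_row_val.
move=> t; apply: (@continuous_max R T (fun t => row_val (v t) q)
    (fun t => foldr _ _ s)); [exact: continuous_row_val|exact: ih].
Qed.

End lattice_terms.

(** Replacing indices by their positions in the list of those occurring splits a term into a code
    from a countable set and a finite list. *)
Lemma term_renaming (R : realType) (X : eqType) (x0 : X) (t : lattice_term X) :
  exists (t' : lattice_term nat) (s : seq X), forall v : X -> R,
    term_val (fun k => v (nth x0 s k)) t' = term_val v t.
Proof.
pose s := [seq p.2 | p <- flatten [seq r.1 :: r.2 | r <- t.1 :: t.2]].
exists (map_term (index^~ s) t), s => v; rewrite term_val_map.
set g : X -> X := fun k => nth x0 s (index k s).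
have gid r p : r \in t.1 :: t.2 -> p \in r.1 :: r.2 -> (p.1, g p.2) = p.
  move=> rt pr; rewrite /g nth_index; first by case: p pr.
  apply/mapP; exists p => //; apply/flatten_mapP; exists r => //.
have rid r : r \in t.1 :: t.2 -> map_row g r = r.
  move=> rt; rewrite /map_row (gid r)//; last exact: mem_head.
  rewrite map_id_in; first by case: r rt.
  by move=> p pr; apply: (gid r) => //; rewrite inE pr orbT.
suff : map_term g t = t by move=> tid; rewrite -[in RHS]tid term_val_map.
rewrite /map_term rid ?mem_head// map_id_in; first by case: t {s g gid rid}.
by move=> r rt; apply: rid; rewrite inE rt orbT.
Qed.

Lemma rat_approx (R : realType) (a e : R) :
  0 < e -> exists q : rat, `|ratr q - a| < e.
Proof.
move=> e0; have [|q] := @rat_in_itvoo R (a - e) (a + e); first by lra.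
rewrite in_itv/= => /andP[aq qa]; exists q; rewrite ltr_norml.
by apply/andP; split; lra.
Qed.

(** * Lattice Stone-Weierstrass with rational coefficients *)

Section lattice_approximation.
Context (R : realType) (K : topologicalType) (X : eqType) (x0 : X).
Context (v : K -> X -> R) (f : K -> R) (e : R).
Hypotheses (cK : compact [set: K]) (cv : forall k, continuous (v^~ k)).
Hypothesis cf : continuous f.
Hypothesis vsep : forall x y, (forall k, v x k = v y k) -> x = y.
Hypothesis e0 : 0 < e.

Let interpolate x y : exists p : affine_term X,
  `|affine_val (v x) p - f x| < e /\ `|affine_val (v y) p - f y| < e.
Proof.
have [->|xy] := eqVneq x y.
  have [q qf] := rat_approx (f y) e0.
  by exists (0, q, x0); rewrite /affine_val/= rmorph0 mul0r add0r.
have [k vk] : exists k, v x k <> v y k.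
  by apply/existsNP => vxy; move/eqP: xy; apply; exact: vsep.
have d0 : v x k - v y k != 0 by rewrite subr_eq0; exact/eqP.
pose a := (f x - f y) / (v x k - v y k); pose b := f x - a * v x k.
(* With this bound, an error [e / 2 / M] in the slope costs at most [e / 2] at [x] and at [y]. *)
pose M := 1 + `|v x k| + `|v y k|.
have M0 : 0 < M by rewrite /M -addrA ltr_pwDl// addr_ge0.
have [q qa] : exists q : rat, `|ratr q - a| < e / 2 / M.
  by apply: rat_approx; rewrite !divr_gt0.
have [r rb] : exists r : rat, `|ratr r - b| < e / 2.
  by apply: rat_approx; rewrite divr_gt0.
have bound c : `|c| <= M -> `|ratr q * c + ratr r - (a * c + b)| < e.
  move=> cM.
  rewrite (_ : _ - _ = (ratr q - a) * c + (ratr r - b)); last by ring.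
  apply: le_lt_trans (ler_normD _ _) _; rewrite normrM [ltRHS](splitr e).
  apply: ler_ltD rb; apply: le_trans (_ : e / 2 / M * M <= _); last first.
    by rewrite divfK// gt_eqF.
  by apply: ler_pM => //; exact: ltW.
exists (q, r, k); rewrite /affine_val/=; split.
  rewrite (_ : f x = a * v x k + b); last by rewrite /b; ring.
  by apply: bound; rewrite /M; have := normr_ge0 (v y k); lra.
rewrite (_ : f y = a * v y k + b); last by rewrite /b /a; field.
by apply: bound; rewrite /M; have := normr_ge0 (v x k); lra.
Qed.

(** For each [x], a minimum of finitely many interpolants stays below [f + e] everywhere and above
    [f - e] near [x]; a maximum of finitely many such rows does both everywhere. *)
Lemma lattice_approximation :
  exists t : lattice_term X, forall x, `|term_val (v x) t - f x| < e.
Proof.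
have [[k0 _]|K0] := pselect (exists k : K, True); last first.
  by exists ((0, 0, x0, [::]), [::]) => x; case: K0; exists x.
have /choice[h hP] : forall xy : K * K, exists p : affine_term X,
    `|affine_val (v xy.1) p - f xy.1| < e /\
    `|affine_val (v xy.2) p - f xy.2| < e.
  by move=> [x y]; exact: interpolate.
have open_lt_of (g g' : K -> R) : continuous g -> continuous g' ->
    open [set t | g t < g' t].
  move=> cg cg'.
  rewrite (_ : mkset _ = (fun t => g' t - g t) @^-1` [set u | 0 < u]).
    apply: open_comp; last exact: open_gt.
    by move=> t _; exact: cvgB (cg' t) (cg t).
  by apply/seteqP; split=> t /=; rewrite subr_gt0.
have rows x : exists r : row_term X,
    (forall t, row_val (v t) r < f t + e) /\ f x - e < row_val (v x) r.
  have [|y|s sP] := @compact_seq_cover K K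
    (fun y => [set t | affine_val (v t) (h (x, y)) < f t + e]) cK.
  - move=> y; apply: open_lt_of; first exact: continuous_affine_val.
    by move=> t; apply: cvgD; [exact: cf|exact: cvg_cst].
  - exists y; have [_] := hP (x, y); rewrite ltr_norml/= => /andP[_].
    by rewrite ltrBlDl addrC.
  - exists (h (x, x), [seq h (x, y) | y <- s]); split.
      move=> t; have [y ys yt] := sP t; apply: le_lt_trans yt.
      by apply: row_val_le; rewrite inE map_f ?orbT.
    apply: row_val_gt => p /=; rewrite -map_cons => /mapP[y _ ->].
    by have [+ _] := hP (x, y); rewrite ltr_norml/= => /andP[+ _]; lra.
have {rows}/choice[r rP] := rows.
have [|y|s sP] := @compact_seq_cover K K
  (fun y => [set t | f t - e < row_val (v t) (r y)]) cK.
- move=> y; apply: open_lt_of; last exact: continuous_row_val.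
  by move=> t; apply: cvgB; [exact: cf|exact: cvg_cst].
- by exists y; have [] := rP y.
exists (r k0, map r s) => x; rewrite ltr_norml; apply/andP; split.
  have [y ys yx] := sP x; rewrite ltrBrDl; apply: lt_le_trans yx _.
  by apply: term_val_ge; rewrite inE map_f ?orbT.
rewrite ltrBlDl; apply: term_val_lt => p /=; rewrite -map_cons => /mapP[y _ ->].
by have [] := rP y.
Qed.

End lattice_approximation.

(** * Coding the continuous functions on [K] *)

Section Lkappa_points.
Context (kappa lambda : infinite_cardinal).
Local Notation L := (Lkappa kappa lambda).

Lemma Lkappa_isolated (a : lambda) : nbhs (Some a : L) [set (Some a : L)].
Proof. by apply: open_nbhs_nbhs; split=> //; move=> /=. Qed.

Lemma Lkappa_closed_small (A : set lambda) : A #< [set: kappa] ->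
  closed [set o : L | exists2 a, A a & o = Some a].
Proof.
move=> sA; rewrite -[mkset _]setCK; apply: open_closedC.
move=> _; apply: card_le_lt_trans sA; apply: subset_card_le => a /= /contrapT.
by move=> [b Ab [->]].
Qed.

End Lkappa_points.

Section Lkappa_coding.
Context (R : realType) (K : topologicalType) (kappa : infinite_cardinal).
Hypotheses (unc : uncountable_cardinal kappa) (cK : compact [set: K]).
Context (Gamma : Type) (c : Gamma -> K -> R).
Hypothesis cc : forall g, continuous (c g).
Hypothesis csmall : forall x, [set g | c g x <> 0] #< [set: kappa].
Hypothesis csep : forall x y, (forall g, c g x = c g y) -> x = y.

(** One discrete set holds both the coordinates and the countably many term codes; the codes also
    make it infinite. *)
Let carrier : choiceType := ({classic Gamma} + lattice_term nat)%type.

Let carrier_infinite : infinite_set [set: carrier].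
Proof.
apply/infiniteP.
pose G (n : nat) (a : carrier) := a = inr ((0, 0, n, [::]), [::]).
apply: (@card_le_graph _ _ _ _ G) => [n _|n m a _ _ -> [->//]].
by exists (inr ((0, 0, n, [::]), [::])).
Qed.

Let lambda := InfiniteCardinal carrier_infinite.
Local Notation L := (Lkappa kappa lambda).
Local Notation W := {ptws nat -> L}.
Implicit Types (z : W) (n : nat).

Let phi (o : L) (x : K) : R := if o is Some (inl g) then c g x else 0.

Let phi_continuousl o : continuous (phi o).
Proof.
by case: o => [[g|t]|]; [exact: cc|move=> x; exact: cvg_cst..].
Qed.

(** Only continuity at [None] matters, and there a neighbourhood of 0 can be missed only at the
    small set of [g] with [c g x <> 0]. *)
Let phi_continuousr x : continuous (phi^~ x).
Proof.
apply/continuousP => A oA.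
suff : @Lkappa_open kappa lambda (phi^~ x @^-1` A) by [].
move=> A0; apply: card_le_lt_trans (csmall x).
pose G (a : carrier) (g : Gamma) := a = inl g.
apply: (@card_le_graph _ _ _ _ G) => [[g|t] /= nA|a b g _ _ -> ->//].
  by exists g => // cg; apply: nA; rewrite /preimage/= cg.
by case: nA.
Qed.

(* A point of L_kappa^omega is read as a double sequence: row n holds the code
   of a lattice term followed by the values of its variables. *)
Let head n z : L := z (pickle (n, 0%N)).
Let var n z k : L := z (pickle (n, k.+1)).

Let fn n z x : R :=
  if head n z is Some (inr t) then term_val (fun k => phi (var n z k) x) t
  else 0.

Let coded n z := exists2 a : lambda, (exists t, a = inr t) & head n z = Some a.

Let F : set W := [set z | (forall n, coded n z) /\
  forall n x, `|fn n z x - fn n.+1 z x| <= 2^-1 ^+ n].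

Let fn_continuousl n z : continuous (fn n z).
Proof.
rewrite /fn; case: (head n z) => [[g|t]|]; try by move=> x; exact: cvg_cst.
by apply: continuous_term_val => k; exact: phi_continuousl.
Qed.

(** The code is an isolated point of [L], so near [z] the term is fixed and only its variables
    move. *)
Let fn_continuousr n z x : coded n z -> {for z, continuous (fn n ^~ x)}.
Proof.
move=> [a [t at_] hz]; subst a => A.
pose g z' := term_val (fun k => phi (var n z' k) x) t.
have cg : continuous g.
  apply: (@continuous_term_val R W nat
    (fun z' k => phi (var n z' k) x)) => k z'.
  apply: (@continuous_comp _ _ _ (fun z' : W => var n z' k) (phi^~ x)).
    exact: ptws_eval_continuous.
  exact: phi_continuousr.
have fz : fn n z x = g z by rewrite /fn hz.
rewrite fz => /(cg z); rewrite !nbhs_simpl/= => gA.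
have hn : nbhs z [set z' | head n z' = Some (inr t)].
  have := @ptws_eval_continuous nat L (pickle (n, 0%N)) z
    [set (Some (inr t : lambda) : L)].
  by apply; rewrite -/(head n z) hz; exact: Lkappa_isolated.
by apply: filterS2 gA hn => z' gA; rewrite /= /fn => ->.
Qed.

Let closed_F : closed F.
Proof.
have clc n : closed (coded n).
  pose codes : set lambda := [set a | exists t, a = inr t].
  have := closed_preimage (@ptws_eval_continuous nat L (pickle (n, 0%N)))
    (@Lkappa_closed_small kappa lambda codes _).
  apply; apply: small_countable => //.
  rewrite (_ : codes = range (inr : lattice_term nat -> carrier)).
    apply: (card_le_trans (card_image_le _ _)).
    exact: (@countableP ((rat * rat * nat) * seq (rat * rat * nat) *
      seq ((rat * rat * nat) * seq (rat * rat * nat)))%type).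
  by apply/seteqP; split=> [_ [t ->]|_ [t _ <-]]; exists t.
move=> z clz.
(* This comes first, as continuity of [fn n] in [z] is available at coded points. *)
have zc n : coded n z.
  by apply: clc; apply: (closureS _ clz) => z' [].
split=> // n x; rewrite leNgt; apply/negP => lt_d.
have : nbhs z [set z' | 2^-1 ^+ n < `|fn n z' x - fn n.+1 z' x|].
  have cd : {for z, continuous (fun z' => `|fn n z' x - fn n.+1 z' x|)}.
    have c1 m : (fun z' => fn m z' x) @ z --> fn m z x by exact: fn_continuousr.
    have cd := cvg_norm (cvgB (c1 n) (c1 n.+1)).
    exact: cd.
  apply: (cd [set r | 2^-1 ^+ n < r]); apply: open_nbhs_nbhs.
  by split=> //; exact: open_gt.
by move=> /clz[z' [[_ /(_ n x)]]] /= h; rewrite ltNge h.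
Qed.

Lemma Cp_Lkappa : in_Lkappa_class kappa (Cp R K).
Proof.
split; first exact: Cp_tychonoff.
exists lambda, F; split; first exact: closed_F.
have /choice[lim limP] : forall zx : set_type F * K, exists l : R,
    forall n, `|fn n (set_val zx.1) zx.2 - l| <= 2 * 2^-1 ^+ n.
  move=> [z x]; apply: geometric_limit => n.
  by have [_] := set_valP z; exact.
have clim (y : set_type F) : continuous (fun x => lim (y, x)).
  apply: (continuous_geometric_limit (u := fun n => fn n (set_val y))).
    by move=> n; exact: fn_continuousl.
  by move=> n x; exact: (limP (y, x)).
pose Lim (y : set_type F) : Cp R K := SigSub (mem_set (clim y :
  [set f : {ptws K -> R} | continuous (f : K -> R)] (fun x => lim (y, x)))).
exists Lim; split.
  apply: continuous_to_subtype; apply: continuous_ptws => x.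
  apply: (continuous_geometric_limit
    (u := fun n (y : set_type F) => fn n (set_val y) x)).
    move=> n z; apply: (@continuous_comp _ _ _ set_val (fn n ^~ x)).
      exact: set_val_continuous.
    by apply: fn_continuousr; have [+ _] := set_valP z; exact.
  by move=> n z; exact: (limP (z, x)).
apply/seteqP; split=> // f _.
have cf : continuous (set_val f : K -> R) := set_valP f.
have psep x y : (forall o : L, phi o x = phi o y) -> x = y.
  by move=> pxy; apply: csep => g; exact: (pxy (Some (inl g))).
(* Consecutive tolerances add up to three quarters of [2^-1 ^+ n], within the bound in [F]. *)
have /choice[ts tsP] : forall n, exists ts : lattice_term nat * seq L, forall x,
    `|term_val (fun k => phi (nth None ts.2 k) x) ts.1 - set_val f x| <
    2^-1 ^+ n / 2.
  move=> n; have e0 : 0 < 2^-1 ^+ n / 2 :> R by rewrite divr_gt0 ?exprn_gt0.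
  have [t tP] := lattice_approximation (None : L) (v := fun x o => phi o x)
    cK phi_continuousl cf psep e0.
  have [t' [s t's]] := term_renaming R (None : L) t.
  by exists (t', s) => x; rewrite /= (t's (phi^~ x)).
pose z : W := fun m => if unpickle m is Some (n, j) then
  if j is k.+1 then nth None (ts n).2 k else Some (inr (ts n).1) else None.
have zc n : head n z = Some (inr (ts n).1) by rewrite /head /z pickleK.
have zfn n x : `|fn n z x - set_val f x| < 2^-1 ^+ n / 2.
  rewrite /fn zc (_ : (fun k => _) = (fun k => phi (nth None (ts n).2 k) x)) //.
  by apply/funext => k; rewrite /var /z pickleK.
have Fz : F z.
  split=> [n|n x]; first by eexists; [exists (ts n).1|exact: zc].
  have := zfn n x; have := zfn n.+1 x; rewrite exprS !ltr_norml ler_norml.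
  have : 0 <= 2^-1 ^+ n :> R by rewrite exprn_ge0.
  set p := 2^-1 ^+ n => p0 /andP[? ?] /andP[? ?].
  by apply/andP; split; lra.
exists (SigSub (mem_set Fz)) => //; apply: val_inj; apply/funext => x /=.
apply/eqP; rewrite -subr_eq0 -normr_le0 leNgt; apply/negP => d0.
set l := lim _ in d0 *.
(* The two limits are within [2 + 1/2] times [2^-1 ^+ n] of each other, less than their distance for
   this [n]. *)
have [|n] := @geometric_small R (`|l - set_val f x| / 2) _.
  by rewrite divr_gt0.
have := limP (SigSub (mem_set Fz), x) n; have := zfn n x; rewrite /= -/l.
have : 0 <= 2^-1 ^+ n :> R by rewrite exprn_ge0.
rewrite distrC (distrC _ l); have := ler_distD (fn n z x) l (set_val f x).
by rewrite (distrC (set_val f x)); set p := 2^-1 ^+ n; lra.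
Qed.

End Lkappa_coding.

Theorem theorem5p8 (R : realType) (K : topologicalType)
    (kappa : infinite_cardinal) :
  tychonoff_space K -> compact [set: K] ->
  uncountable_cardinal kappa -> regular_cardinal kappa ->
  Corson_compact R kappa K <-> in_Lkappa_class kappa (Cp R K).
Proof.
move=> tK cK unc reg; split; last exact: Corson_of_Lkappa.
move=> [_ _ [Gamma [A [Asmall [f [g [cf cg fg gf]]]]]]].
apply: (Cp_Lkappa unc cK (c := fun gamma x => set_val (f x) gamma)).
- move=> gamma x; apply: (continuous_comp (f := set_val \o f)
    (g := fun w : {ptws Gamma -> R} => w gamma)); last exact: ptws_eval_continuous.
  by apply: continuous_comp; [exact: cf|exact: set_val_continuous].
- by move=> x; apply: Asmall; exact: set_valP.
- move=> x y fxy; rewrite -(fg x) -(fg y); congr g; apply: val_inj.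
  exact/funext.
Qed.
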